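(* Let $\Gamma = \langle v_0,\ldots,v_g\rangle$ be a numerical semigroup with minimal generators $v_0<\cdots<v_g$ and conductor $c$, such that $S_{dec}(\Gamma)$ contains a single polynomial of weighted order strictly less than $c$, and let $d$ denote its weighted order. Then $$\mathcal{R}_\Gamma \leftrightarrow \mathbb{C}^{N(\Gamma)} \subseteq \mathbb{C}^{M(\Gamma)},$$ that is, the affine variety in $\mathbb{C}^{M(\Gamma)}$ corresponding to $\mathcal{R}_\Gamma$ is identified with (is isomorphic to) the affine space $\mathbb{C}^{N(\Gamma)}$, where $$M(\Gamma) = \sum_{i=0}^g \#\{\text{gaps of } \Gamma \text{ greater than } v_i\}$$ and $$N(\Gamma) = M(\Gamma) - \#\{\text{gaps of } \Gamma \text{ greater than } d\}.$$
   Context: $\mathbb{N}$ contains $0$. A numerical semigroup $\Gamma \subseteq \mathbb{N}$ is a subset containing $0$, closed under addition, and containing all sufficiently large integers; its conductor $c$ is the element with $c-1 \notin \Gamma$ and $n \in \Gamma$ for all $n \geq c$. A gap of $\Gamma$ is an element of $\mathbb{N}\setminus\Gamma$. $\mathcal{R}_\Gamma$ is the set of complete $\mathbb{C}$-subalgebras of $\mathbb{C}[[t]]$ with semigroup (set of orders of nonzero elements) equal to $\Gamma$. Since every such subalgebra contains the ideal $(t^c)$, $\mathcal{R}_\Gamma$ is identified with the set of $\mathbb{C}$-subalgebras $R$ of $\mathbb{C}[t]/(t^c)$ with $\Gamma_R = \Gamma$, where $\Gamma_R = \{n \mid \exists f \in R\setminus\{0\},\ \operatorname{ord} f = n\} \cup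 \{n \in \mathbb{N} \mid n \geq c\}$. A set $\{x_0(t),\ldots,x_g(t)\}\subset \mathbb{C}[t]/(t^c)$ is in normal form with respect to $\Gamma$ if $x_i(t) = t^{v_i} + \sum_\delta a_{i,\delta}t^\delta$ for each $i$, the sum running over gaps $\delta > v_i$ of $\Gamma$ (with $x_i(t)=0$ if $v_i \geq c$). Sets in normal form are identified with points $(a_{i,\delta})$ of $\mathbb{C}^{M(\Gamma)}$. Every $R \in \mathcal{R}_\Gamma$ is generated by a unique set in normal form, and the affine variety corresponding to $\mathcal{R}_\Gamma$ is the set of points of $\mathbb{C}^{M(\Gamma)}$ for which the generated ring $\mathbb{C}[x_0(t),\ldots,x_g(t)]$ lies in $\mathcal{R}_\Gamma$; it is a Zariski closed subset of $\mathbb{C}^{M(\Gamma)}$. The ring $\mathbb{C}[x_0,\ldots,x_g]$ is graded with $x_i$ of weight $v_i$. $S_{dec}(\Gamma)$ is the set of polynomials $x_0^{i_0}\cdots x_g^{i_g} - x_0^{i_0'}\cdots x_g^{i_g'}$ with (i) $i_j,i_j' \in \mathbb{N}$ and $(i_0,\ldots,i_g) \neq (i_0',\ldots,i_g')$; (ii) $i_m < i_m'$ where $m$ is the smallest $j$ with $i_j \neq i_j'$; (iii) $\sum_{j=0}^g i_j v_j = \sum_{j=0}^g i_j' v_j$ (this common value is the weighted order, equal to the weighted degree). *)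

(* Defs.v *)
From HB Require Import structures.
From mathcomp Require Import all_boot all_order all_algebra.
From mathcomp Require Import boolp classical_sets functions reals.
From mathcomp Require Import complex.
From mathcomp Require Import mpoly.

Set Implicit Arguments.
Unset Strict Implicit.
Unset Printing Implicit Defensive.

Import GRing.Theory.

Local Open Scope classical_set_scope.
Local Open Scope ring_scope.

Definition numerical_semigroup (Gamma : set nat) : Prop :=
  [/\ Gamma 0%N,
      forall m n, Gamma m -> Gamma n -> Gamma (m + n)%N
    & exists N, forall n, (N <= n)%N -> Gamma n].

(* For [Gamma = nat] the conductor is [0], the condition on [c - 1 = -1] being
   vacuous. *)
Definition is_conductor (Gamma : set nat) (c : nat) : Prop :=
  (forall n, (c <= n)%N -> Gamma n) /\ (forall n, c = n.+1 -> ~ Gamma n).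

Definition semigroup_span (k : nat) (v : 'I_k -> nat) (J : {set 'I_k}) :
    set nat :=
  [set n | exists e : 'I_k -> nat, n = (\sum_(j in J) e j * v j)%N].

Definition minimal_generators (Gamma : set nat) (k : nat) (v : 'I_k -> nat) :
    Prop :=
  Gamma = semigroup_span v [set: 'I_k]%SET /\
  forall J : {set 'I_k}, Gamma = semigroup_span v J -> J = [set: 'I_k]%SET.

(* Every gap of a semigroup of conductor [c] is smaller than [c], so counting
   in ['I_c] counts them all. *)
Definition gaps_gt (Gamma : set nat) (c n : nat) : nat :=
  #|[pred x : 'I_c | (val x \notin Gamma) && (n < x)%N]|.

Definition M_of (Gamma : set nat) (c k : nat) (v : 'I_k -> nat) : nat :=
  (\sum_(i < k) gaps_gt Gamma c (v i))%N.

(* The subtraction never truncates when [d] is at least some [v i]. *)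
Definition N_of (Gamma : set nat) (c k : nat) (v : 'I_k -> nat) (d : nat) :
    nat :=
  (M_of Gamma c v - gaps_gt Gamma c d)%N.

Definition wdeg (k : nat) (v : 'I_k -> nat) (m : 'X_{1..k}) : nat :=
  (\sum_(j < k) m j * v j)%N.

(* The least weighted degree of a monomial of [P]; the value at [P = 0] is
   irrelevant. *)
Definition worder (K : fieldType) (k : nat) (v : 'I_k -> nat)
    (P : {mpoly K[k]}) : nat :=
  \big[minn/wdeg v (mlead P)]_(m <- msupp P) wdeg v m.

Definition S_dec (K : fieldType) (k : nat) (v : 'I_k -> nat) :
    set {mpoly K[k]} :=
  [set P | exists e e' : 'X_{1..k},
     [/\ e <> e',
         exists m : 'I_k,
           (forall j : 'I_k, (j < m)%N -> e j = e' j) /\ (e m < e' m)%N,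
         wdeg v e = wdeg v e'
       & P = 'X_[e] - 'X_[e'] ] ].
Arguments S_dec K {k} v.

(* [{poly %/ 'X^c}] is K[t]/(t^c) only for [c > 0]; for [c = 0] the library
   quotients by ['X] instead of returning the zero ring. *)
Notation truncated K c := {poly %/ ('X^c : {poly K})}.

Definition trunc_ord (K : fieldType) (c : nat) (f : truncated K c) : nat :=
  find (fun a : K => a != 0) (f : {poly K}).

Definition semigroup_of (K : fieldType) (c : nat) (A : set (truncated K c)) :
    set nat :=
  [set n | exists2 f, A f & f != 0 /\ trunc_ord f = n] `|`
  [set n | (c <= n)%N].

Definition subalgebra (K : fieldType) (c : nat) (A : set (truncated K c)) :
    Prop :=
  GRing.subalg_closed [pred f | f \in A].

Definition algebras_of (K : fieldType) (Gamma : set nat) (c : nat) :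
    set (set (truncated K c)) :=
  [set A | subalgebra A /\ semigroup_of A = Gamma].
Arguments algebras_of K Gamma c : clear implicits.

Definition generated_ring (K : fieldType) (c k : nat)
    (x : 'I_k -> truncated K c) : set (truncated K c) :=
  [set f | exists P : {mpoly K[k]},
     f = mmap (in_alg (truncated K c)) x P].

(* The coordinate directions [a_(i, delta)] of [K^M(Gamma)]. *)
Definition gap_coord (Gamma : set nat) (c k : nat) (v : 'I_k -> nat) : finType :=
  {p : 'I_k * 'I_c | (val p.2 \notin Gamma) && (v p.1 < p.2)%N}.

Lemma card_gap_coord (Gamma : set nat) (c k : nat) (v : 'I_k -> nat) :
  #|gap_coord Gamma c v| = M_of Gamma c v.
Proof.
rewrite card_sig /M_of -sum1_card.
under [RHS]eq_bigr => i _ do rewrite /gaps_gt -sum1_card.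
by rewrite pair_big_dep; apply: eq_bigl => -[i x].
Qed.

(* When [c <= v i] this is [0], as ['X^(v i)] is zero in the quotient and no
   gap exceeds [v i]. *)
Definition normal_form (K : fieldType) (Gamma : set nat) (c k : nat)
    (v : 'I_k -> nat) (a : {ffun gap_coord Gamma c v -> K}) (i : 'I_k) :
    truncated K c :=
  in_qpoly 'X^c
    ('X^(v i) + \sum_(p : gap_coord Gamma c v | (val p).1 == i)
                  a p *: 'X^((val p).2)).

Definition variety_of (K : fieldType) (Gamma : set nat) (c k : nat)
    (v : 'I_k -> nat) : set {ffun gap_coord Gamma c v -> K} :=
  [set a | algebras_of K Gamma c (generated_ring (normal_form a))].
Arguments variety_of K Gamma c {k} v.

Definition peval (K : fieldType) (I : finType) (p : {mpoly K[#|I|]})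
    (a : {ffun I -> K}) : K :=
  p.@[fun k => a (enum_val k)].

Definition polymap (K : fieldType) (I J : finType)
    (F : J -> {mpoly K[#|I|]}) (a : {ffun I -> K}) : {ffun J -> K} :=
  [ffun j => peval (F j) a].

Definition zariski_closed (K : fieldType) (I : finType)
    (V : set {ffun I -> K}) : Prop :=
  exists S : set {mpoly K[#|I|]},
    V = [set a | forall p, S p -> peval p a = 0].

Definition affine_isomorphic (K : fieldType) (I J : finType)
    (V : set {ffun I -> K}) (W : set {ffun J -> K}) : Prop :=
  exists (F : J -> {mpoly K[#|I|]}) (G : I -> {mpoly K[#|J|]}),
    [/\ forall a, V a -> W (polymap F a),
        forall b, W b -> V (polymap G b),
        forall a, V a -> polymap G (polymap F a) = a
      & forall b, W b -> polymap F (polymap G b) = b].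

(* Main.v *)
Require Import Defs.
From HB Require Import structures.
From mathcomp Require Import all_boot all_order all_algebra.
From mathcomp Require Import boolp classical_sets functions reals.
From mathcomp Require Import complex.
From mathcomp Require Import mpoly.
From mathcomp Require Import ring zify.

Set Implicit Arguments.
Unset Strict Implicit.
Unset Printing Implicit Defensive.

Local Open Scope classical_set_scope.
Local Open Scope ring_scope.
Import GRing.Theory.

(** Write x_i(a) for the normal form with coordinates a, and give the coordinate
    a_(i,delta) the weight delta - v_i > 0.

    An algebra generated by a normal form is spanned by the monomials in the
    x_i, and a monomial of weighted degree n has order n.  By hypothesis the
    only two distinct monomials that share a degree below c are the two terms
    x^e and x^e' of P, of degree d.  So the algebra is spanned by one monomial
    for each element of Gamma below c together with f = x^e(a) - x^e'(a), and
    its semigroup is Gamma exactly when f vanishes after its coefficients at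
    the orders in Gamma have been eliminated with those monomials ([reduce]).
    What remains of f lives at the gaps n > d; its coefficients there are
    polynomials in a, called obstructions ([obstruction]), and [variety_pivots]
    says that they cut out the variety.

    The coefficient of t^(d+w) in f is homogeneous of weight w in a.  So it
    contains the coordinates of weight w only linearly, a_(i,v_i+w) with
    coefficient e_i - e'_i, and if d+w is a gap, elimination only
    alters it by terms in coordinates of weight below w.  Fix i0 with
    e_i0 < e'_i0.  If d+w is a gap, so is v_i0+w, because d - v_i0 lies in
    Gamma; thus a_(i0,v_i0+w) is a coordinate, and the obstruction at d+w can be
    solved for it in terms of the other coordinates of weight at most w, the
    coefficient e_i0 - e'_i0 being nonzero in characteristic 0.  The equations
    form a triangular system with one pivot for each gap above d, so the variety
    is the graph of a polynomial map over the space of the remaining N(Gamma)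
    coordinates
    ([pivot_triangular], [triangular_affine_isomorphic]).

    Homogeneity is expressed by comparing two points a and b: if they agree in
    weights below w, the coefficients concerned agree up to the order where
    weight w enters, and their difference at that order is the linear term
    ([congr_upto], [reduce_congr]).

    That points of the variety correspond bijectively to algebras is a matter
    of elimination too: t^(v_i) minus what remains of it after elimination with
    elements of the algebra is the i-th generator in normal form, and the
    difference of two i-th generators in normal form that lie in one algebra has
    no coefficient at an order in Gamma, hence vanishes
    ([normal_form_inj], [normal_form_surj]). *)

(** * Polynomial functions and triangular systems *)

Definition polynomial_fun (K : fieldType) (I : finType)
    (f : {ffun I -> K} -> K) : Prop :=
  exists p : {mpoly K[#|I|]}, forall a, f a = peval p a.

Section PolynomialFunctions.
Variables (K : fieldType) (I : finType).
Implicit Types f g : {ffun I -> K} -> K.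

Lemma polynomial_cst (x : K) : polynomial_fun (fun _ : {ffun I -> K} => x).
Proof. by exists x%:MP => a; rewrite /peval mevalC. Qed.

Lemma polynomial_coord (i : I) : polynomial_fun (fun a : {ffun I -> K} => a i).
Proof. by exists 'X_(enum_rank i) => a; rewrite /peval mevalXU enum_rankK. Qed.

Lemma polynomialD f g : polynomial_fun f -> polynomial_fun g ->
  polynomial_fun (fun a => f a + g a).
Proof.
by move=> [p fE] [q gE]; exists (p + q) => a; rewrite /peval mevalD fE gE.
Qed.

Lemma polynomialM f g : polynomial_fun f -> polynomial_fun g ->
  polynomial_fun (fun a => f a * g a).
Proof.
by move=> [p fE] [q gE]; exists (p * q) => a; rewrite /peval mevalM fE gE.
Qed.

Lemma polynomialN f : polynomial_fun f -> polynomial_fun (fun a => - f a).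
Proof. by move=> [p fE]; exists (- p) => a; rewrite /peval mevalN fE. Qed.

Lemma polynomialB f g : polynomial_fun f -> polynomial_fun g ->
  polynomial_fun (fun a => f a - g a).
Proof. by move=> fP gP; apply/polynomialD/polynomialN. Qed.

Lemma eq_polynomial f g : f =1 g -> polynomial_fun f -> polynomial_fun g.
Proof. by move=> fg [p fE]; exists p => a; rewrite -fg. Qed.

Lemma polynomial_sum (J : Type) (r : seq J) (P : pred J)
    (F : J -> {ffun I -> K} -> K) :
  (forall j, polynomial_fun (F j)) ->
  polynomial_fun (fun a => \sum_(j <- r | P j) F j a).
Proof.
move=> FP; elim: r => [|j r IHr].
  by apply: eq_polynomial (polynomial_cst 0) => a; rewrite big_nil.
apply: (@eq_polynomial
  (fun a => (if P j then F j a else 0) + \sum_(i <- r | P i) F i a)).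
  by move=> a; rewrite big_cons; case: ifP; rewrite ?add0r.
by apply: polynomialD IHr; case: (P j) => //; apply: polynomial_cst.
Qed.

Lemma polynomial_comp (J : finType) (f : {ffun J -> K} -> K)
    (phi : {ffun I -> K} -> {ffun J -> K}) :
  polynomial_fun f -> (forall j, polynomial_fun (fun a => phi a j)) ->
  polynomial_fun (fun a => f (phi a)).
Proof.
move=> [p fE] /choice[q qE].
exists (p \mPo [tuple q (enum_val j) | j < #|J|]) => a.
rewrite fE /peval comp_mpoly_meval; apply: meval_eq => j.
by rewrite tnth_mktuple qE.
Qed.

End PolynomialFunctions.

(** Each pivot y in D comes with an equation E y = 0.  Hypothesis [triE] says
    that E y - slope * y depends only on the free coordinates and on the pivots
    of weight below that of y. *)
Section TriangularSystem.
Variables (K : fieldType) (I : finType) (D : pred I) (w : I -> nat).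
Variables (E : I -> {ffun I -> K} -> K) (slope : K).
Hypothesis slope_neq0 : slope != 0.
Hypothesis polyE : forall y, D y -> polynomial_fun (E y).
Hypothesis triE : forall y (a b : {ffun I -> K}), D y ->
  (forall p, ~~ D p \/ (w p < w y)%N -> a p = b p) ->
  E y a - E y b = slope * (a y - b y).

Let V : set {ffun I -> K} := [set a | forall y, D y -> E y a = 0].

(** One sweep of substitutions solves the equations of the lowest unsolved
    weight and leaves the solved ones untouched. *)
Let relax (a : {ffun I -> K}) : {ffun I -> K} :=
  [ffun i => if D i then a i - slope^-1 * E i a else a i].

Let height := (\max_i w i).+1.

Let relax_free n (a : {ffun I -> K}) i : ~~ D i -> iter n relax a i = a i.
Proof. by move=> Di; elim: n => //= n IHn; rewrite ffunE (negbTE Di). Qed.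

Let relax_solves n a y : D y -> (w y < n)%N -> E y (iter n relax a) = 0.
Proof.
elim: n y => // n IHn y Dy; rewrite ltnS iterS => le_yn.
set b := iter n relax a in IHn *.
have := @triE y (relax b) b Dy; rewrite ffunE Dy.
have step p : ~~ D p \/ (w p < w y)%N -> relax b p = b p.
  rewrite ffunE; case: ifP => // Dp [//|lt_py].
  by rewrite IHn ?mulr0 ?subr0 // (leq_trans lt_py).
move/(_ step); rewrite addrAC subrr add0r mulrN mulVKf //.
by move/eqP; rewrite subr_eq addNr => /eqP.
Qed.

Let sol := iter height relax.

Let solV a : V (sol a).
Proof. by move=> y Dy; apply: relax_solves => //; rewrite ltnS leq_bigmax. Qed.

Let V_inj a b : V a -> V b -> (forall i, ~~ D i -> a i = b i) -> a = b.
Proof.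
move=> Va Vb ab.
suff eqD n y : D y -> (w y < n)%N -> a y = b y.
  apply/ffunP => y; have [Dy|] := boolP (D y); last exact: ab.
  exact: eqD (leqnn (w y).+1).
elim: n y => // n IHn y Dy; rewrite ltnS => le_yn.
have := @triE y a b Dy; rewrite Va // Vb // subrr => triD.
apply/eqP; rewrite -subr_eq0; apply/eqP/(mulfI slope_neq0); rewrite mulr0.
apply/esym/triD => p [|lt_py]; first exact: ab.
have [Dp|] := boolP (D p); last exact: ab.
by apply: IHn => //; apply: leq_trans le_yn.
Qed.

Let sol_polynomial i : polynomial_fun (fun a => sol a i).
Proof.
rewrite /sol; elim: height i => [|n IHn] i; first exact: polynomial_coord.
have [Di|Di] := boolP (D i); last first.
  by apply: eq_polynomial (IHn i) => a; rewrite /= ffunE (negbTE Di).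
apply: (@eq_polynomial _ _
  (fun a => iter n relax a i - slope^-1 * E i (iter n relax a))).
  by move=> a; rewrite /= ffunE Di.
apply: polynomialB => //; apply: polynomialM; first exact: polynomial_cst.
by apply: polynomial_comp => //; apply: polyE.
Qed.

(** The ideal of all polynomials vanishing on V contains the equations. *)
Lemma triangular_zariski_closed : zariski_closed V.
Proof.
exists [set p | forall a, V a -> peval p a = 0].
apply/seteqP; split=> [a Va p /(_ _ Va) //|a all0 y Dy].
have [p pE] := polyE Dy; rewrite pE; apply: all0 => b Vb.
by rewrite -pE; apply: Vb.
Qed.

(** A point of V is determined by its free coordinates ([V_inj]), and iterating
    [relax] from any values of them reaches a point of V without changing them:
    projection to the free coordinates and [sol] are inverse to each other. *)
Lemma triangular_affine_isomorphic N : N = #|[predC D]| ->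
  affine_isomorphic V [set: {ffun 'I_N -> K}].
Proof.
move=> ->.
pose proj (a : {ffun I -> K}) : {ffun 'I_#|[predC D]| -> K} :=
  [ffun j => a (enum_val j)].
pose incl (b : {ffun 'I_#|[predC D]| -> K}) : {ffun I -> K} :=
  [ffun i => \sum_(j | enum_val j == i) b j].
have inclE b j : incl b (enum_val j) = b j.
  by rewrite ffunE (big_pred1 j) // => j' /=; rewrite (inj_eq enum_val_inj).
have free_enum (j : 'I_#|[predC D]|) : ~~ D (enum_val j).
  by have := enum_valP j.
have proj_sol b : proj (sol (incl b)) = b.
  by apply/ffunP => j; rewrite ffunE relax_free ?inclE.
have [F FE] : exists F : 'I_#|[predC D]| -> {mpoly K[#|I|]},
    forall a, polymap F a = proj a.
  have /choice[F FE] j : exists p : {mpoly K[#|I|]},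
      forall a, proj a j = peval p a.
    apply: eq_polynomial (polynomial_coord _ (enum_val j)) => a.
    by rewrite ffunE.
  by exists F => a; apply/ffunP => j; rewrite ffunE FE.
have [G GE] : exists G : I -> {mpoly K[#|'I_(#|[predC D]|)|]},
    forall b, polymap G b = sol (incl b).
  have /choice[G GE] i : exists p : {mpoly K[#|'I_(#|[predC D]|)|]},
      forall b, sol (incl b) i = peval p b.
    apply: (polynomial_comp (sol_polynomial i)) => i'.
    apply: (@eq_polynomial _ _
      (fun b : {ffun 'I_#|[predC D]| -> K} => \sum_(j | enum_val j == i') b j)).
      by move=> b; rewrite ffunE.
    by apply: polynomial_sum => j; apply: polynomial_coord.
  by exists G => b; apply/ffunP => j; rewrite ffunE GE.
exists F, G; split=> [//|b _|a Va|b _]; rewrite ?GE ?FE //.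
apply: V_inj => // i Di.
have iP : i \in [predC D] by [].
by rewrite relax_free // -(enum_rankK_in iP iP) inclE ffunE.
Qed.

End TriangularSystem.

(** * Elimination of the coefficients at orders in the semigroup *)

Section Elimination.
Variables (K : fieldType) (Gamma : set nat).
Implicit Types (B : nat -> {poly K}) (p q : {poly K}).

Definition leading_at n p : Prop := p`_n = 1 /\ forall m, (m < n)%N -> p`_m = 0.

Lemma leading_atXn n : leading_at n 'X^n.
Proof. by split=> [|m lt_mn]; rewrite coefXn ?eqxx // ltn_eqF. Qed.

Definition eliminate B n p := if n \in Gamma then p - p`_n *: B n else p.

(** Orders are treated increasingly: eliminating at n only alters coefficients
    at n and above, so the zeros produced earlier survive. *)
Fixpoint reduce B j p :=
  if j is n.+1 then eliminate B n (reduce B n p) else p.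

Lemma reduceB B j p q : reduce B j (p - q) = reduce B j p - reduce B j q.
Proof.
elim: j => //= n ->; rewrite /eliminate; case: ifP => // _.
by rewrite coefB scalerBl; move: (_ *: _) (_ *: _) => x y; ring.
Qed.

Lemma reduceZ B j x p : reduce B j (x *: p) = x *: reduce B j p.
Proof.
elim: j => //= n ->; rewrite /eliminate; case: ifP => // _.
by rewrite coefZ -scalerA -scalerBr.
Qed.

Lemma reduce0 B j : reduce B j 0 = 0.
Proof. by rewrite -[in LHS](subrr 0) reduceB subrr. Qed.

Lemma reduceD B j p q : reduce B j (p + q) = reduce B j p + reduce B j q.
Proof.
by rewrite -[in LHS](opprK q) reduceB -[- q]sub0r reduceB reduce0 sub0r opprK.
Qed.

Section Leading.
Variable B : nat -> {poly K}.
Hypothesis leadB : forall n, n \in Gamma -> leading_at n (B n).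

Lemma eliminate_low n p m : (m < n)%N -> (eliminate B n p)`_m = p`_m.
Proof.
rewrite /eliminate; case: ifP => // /leadB[_ low] lt_mn.
by rewrite coefB coefZ low // mulr0 subr0.
Qed.

Lemma eliminate_id n p : p`_n = 0 -> eliminate B n p = p.
Proof. by rewrite /eliminate => ->; rewrite scale0r subr0 if_same. Qed.

Lemma reduce_low j N p : (forall m, (m < N)%N -> p`_m = 0) ->
  forall m, (m < N)%N -> (reduce B j p)`_m = 0.
Proof.
move=> low; elim: j => //= n IHn m lt_mN.
case: (leqP N n) => [le_Nn|lt_nN]; last by rewrite eliminate_id ?IHn.
by rewrite eliminate_low ?IHn // (leq_trans lt_mN).
Qed.

Lemma reduce_gap_lead j n p : n \notin Gamma ->
  (forall m, (m < n)%N -> p`_m = 0) -> (reduce B j p)`_n = p`_n.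
Proof.
move=> gapn low; elim: j => //= m IHm.
case: (ltngtP m n) => [lt_mn|lt_nm|].
- by rewrite eliminate_id // (reduce_low m low).
- by rewrite eliminate_low.
- by move=> eq_mn; subst m; rewrite /eliminate (negbTE gapn).
Qed.

Lemma reduce_Gamma j n p : (n < j)%N -> n \in Gamma -> (reduce B j p)`_n = 0.
Proof.
move=> + Gn; elim: j => //= m IHm; rewrite ltnS leq_eqVlt => /predU1P[<-|lt_nm].
  by rewrite /eliminate Gn coefB coefZ (leadB Gn).1 mulr1 subrr.
by rewrite eliminate_low ?IHm.
Qed.

Lemma reduce_basis j n : n \in Gamma -> (n < j)%N -> reduce B j (B n) = 0.
Proof.
move=> Gn; have [lead1 low] := leadB Gn.
have before m : (m <= n)%N -> reduce B m (B n) = B n.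
  elim: m => //= m IHm lt_mn; rewrite IHm ?(ltnW lt_mn) //.
  by rewrite eliminate_id // low.
elim: j => //= m IHm; rewrite ltnS leq_eqVlt => /predU1P[<-|lt_nm].
  by rewrite before // /eliminate Gn lead1 scale1r subrr.
by rewrite IHm // eliminate_id ?coef0.
Qed.

Lemma reduce_span (A : {poly K} -> Prop) j p :
  A 0 -> (forall x f g, A f -> A g -> A (x *: f + g)) ->
  (forall n, n \in Gamma -> A (B n)) -> A (p - reduce B j p).
Proof.
move=> A0 Alin AB; elim: j => /= [|n IHn]; first by rewrite subrr.
rewrite /eliminate; case: ifP => // /AB ABn.
by rewrite opprB addrCA; apply: Alin.
Qed.

End Leading.

(** The step of the weight argument that concerns elimination.  At an order n
    with d < n, the coefficient of f and those of B n that reach order d + w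
    are both taken at relative orders below w, where the two situations agree;
    at n = d + w they could differ, but that order is not in the semigroup.
    So elimination changes both coefficients at d + w by the same amount. *)
Lemma reduce_congr B B' d w j (f f' : {poly K}) :
  (forall n, n \in Gamma -> leading_at n (B n)) ->
  (forall n, n \in Gamma -> leading_at n (B' n)) ->
  (forall n k, n \in Gamma -> (k < w)%N ->
    (B n)`_(n + k) = (B' n)`_(n + k)) ->
  (forall k, (k <= d)%N -> f`_k = 0) -> (forall k, (k <= d)%N -> f'`_k = 0) ->
  (forall k, (k < w)%N -> f`_(d + k) = f'`_(d + k)) ->
  (d + w)%N \notin Gamma ->
  (reduce B j f)`_(d + w) - (reduce B' j f')`_(d + w) =
  f`_(d + w) - f'`_(d + w).
Proof.
move=> leadB leadB' eqB f0 f'0 eqf gap.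
suff [//]: (reduce B j f)`_(d + w) - (reduce B' j f')`_(d + w) =
      f`_(d + w) - f'`_(d + w) /\
    forall k, (k < w)%N ->
      (reduce B j f)`_(d + k) = (reduce B' j f')`_(d + k).
elim: j => //= n [].
set r := reduce B n f; set r' := reduce B' n f' => IHw IHk.
case: (leqP n d) => [le_nd|lt_dn].
  (* Nothing to eliminate yet: f and f' still vanish at n. *)
  by rewrite !eliminate_id //; apply: (reduce_low _ _ (N := d.+1)).
rewrite /eliminate; case: ifP => // Gn.
have [leadn lown] := leadB n Gn; have [leadn' lown'] := leadB' n Gn.
have eq_rn k : (k <= w)%N -> n != (d + w)%N ->
    r`_n * (B n)`_(d + k) = r'`_n * (B' n)`_(d + k).
  move=> le_kw neq_n; case: (ltngtP (d + k) n) => [lt|gt|eqn].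
  - by rewrite lown // lown' // !mulr0.
  - have -> : (d + k)%N = (n + (d + k - n))%N by rewrite subnKC // ltnW.
    rewrite eqB //; last by lia.
    congr (_ * _); rewrite -(subnKC (ltnW lt_dn)) IHk //; lia.
  - rewrite eqn leadn leadn' !mulr1 -eqn IHk //.
    rewrite ltn_neqAle le_kw andbT.
    by apply: contra neq_n => /eqP <-; rewrite eqn.
have neq_n : n != (d + w)%N by apply: contraTneq Gn => ->.
split=> [|k lt_kw]; rewrite !coefB !coefZ.
  by rewrite eq_rn // -IHw; ring.
by rewrite IHk // eq_rn // ltnW.
Qed.

End Elimination.

(** * Comparison of two series with the same leading term *)

Section LeadingCongruence.
Variable K : fieldType.
Implicit Types p q : {poly K}.

(** q has leading term t^n, and p agrees with q modulo t^(n+w+1) except for the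
    coefficient of t^(n+w), which differs by x.  The factored form makes the
    behaviour under products a ring identity. *)
Definition congr_upto n w (x : K) p q : Prop := exists r s,
  q = 'X^n * (1 + 'X * r) /\ p = q + 'X^(n + w) * (x%:P + 'X * s).

Lemma low_Xn n p : (forall m, (m < n)%N -> p`_m = 0) ->
  exists s, p = 'X^n * ((p`_n)%:P + 'X * s).
Proof.
move=> low; exists (drop_poly n.+1 p); apply/polyP => m.
rewrite coefXnM; case: ltnP => [/low //|le_nm].
rewrite coefD coefC coefXM coef_drop_poly subn_eq0.
case: leqP => [le_mn|lt_nm].
  have -> : m = n by lia.
  by rewrite addr0.
by rewrite add0r; congr (p`_ _); lia.
Qed.

Lemma congr_intro n w p q : leading_at n q ->
  (forall k, (k < n + w)%N -> p`_k = q`_k) ->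
  congr_upto n w (p`_(n + w) - q`_(n + w)) p q.
Proof.
move=> [q1 /low_Xn[r]]; rewrite q1 => qE eq_pq.
have [s sE] : exists s, p - q = 'X^(n + w) * (((p - q)`_(n + w))%:P + 'X * s).
  by apply: low_Xn => m lt_m; rewrite coefB eq_pq ?subrr.
exists r, s; split=> //.
by rewrite -coefB -sE addrC subrK.
Qed.

Lemma congr_leading n w x p q : congr_upto n w x p q -> leading_at n q.
Proof.
case=> r [s [-> _]]; split=> [|m lt_mn]; rewrite coefXnM ?lt_mn //.
by rewrite ltnn subnn coefD coef1 coefXM addr0.
Qed.

Lemma congr_low n w x p q : congr_upto n w x p q ->
  forall k, (k < n + w)%N -> p`_k = q`_k.
Proof. by case=> r [s [_ ->]] k lt_k; rewrite coefD coefXnM lt_k addr0. Qed.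

Lemma congr_diff n w x p q : congr_upto n w x p q ->
  p`_(n + w) - q`_(n + w) = x.
Proof.
case=> r [s [_ ->]]; rewrite coefD coefXnM ltnn subnn coefD coefC coefXM.
by rewrite !eqxx addr0; ring.
Qed.

Lemma congr_1 w : congr_upto 0 w 0 1 1.
Proof. by exists 0, 0; rewrite expr0 !mulr0 !addr0 mulr0 addr0 mulr1. Qed.

(** The discrepancies add up, as for logarithmic derivatives: the leading
    coefficients are 1, and the product of the two discrepancies sits at the
    strictly higher relative order 2(w+1). *)
Lemma congr_mul n n' w x x' p p' q q' :
  congr_upto n w.+1 x p q -> congr_upto n' w.+1 x' p' q' ->
  congr_upto (n + n') w.+1 (x + x') (p * p') (q * q').
Proof.
case=> r [s [-> ->]] [r' [s' [-> ->]]].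
exists (r + r' + 'X * r * r').
exists (s + s' + r * (x'%:P + 'X * s') + r' * (x%:P + 'X * s)
        + 'X^w * (x%:P + 'X * s) * (x'%:P + 'X * s')).
by split; rewrite ?polyCD ?exprD ?exprS; ring.
Qed.

Lemma congr_exp n w x p q m : congr_upto n w.+1 x p q ->
  congr_upto (m * n) w.+1 (m%:R * x) (p ^+ m) (q ^+ m).
Proof.
move=> pq; elim: m => [|m IHm]; first by rewrite mul0r; apply: congr_1.
by rewrite !exprS mulSn mulrS mulrDl mul1r; apply: congr_mul.
Qed.

Lemma congr_prod (I : finType) (n : I -> nat) w (x : I -> K)
    (p q : I -> {poly K}) (m : I -> nat) :
  (forall i, congr_upto (n i) w.+1 (x i) (p i) (q i)) ->
  congr_upto (\sum_i m i * n i) w.+1 (\sum_i (m i)%:R * x i)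
             (\prod_i p i ^+ m i) (\prod_i q i ^+ m i).
Proof.
move=> pq; elim: (index_enum I) => [|i r IHr].
  by rewrite !big_nil; apply: congr_1.
by rewrite !big_cons; apply: congr_mul IHr; apply: congr_exp.
Qed.

End LeadingCongruence.

(** * Subalgebras of the truncated polynomial ring *)

Section TruncatedAlgebras.
Variables (K : fieldType) (c : nat).
Hypothesis c_gt0 : (0 < c)%N.
Local Notation T := (truncated K c).
Local Notation trunc := (in_qpoly ('X^c : {poly K})).
Local Notation lift z := (z : {poly K}).
Implicit Types (p q : {poly K}) (z : T) (A : set T).

Lemma mk_monic_trunc : mk_monic ('X^c : {poly K}) = 'X^c.
Proof. by rewrite /mk_monic size_polyXn ltnS c_gt0 monicXn. Qed.

Lemma size_trunc z : (size (lift z) <= c)%N.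
Proof.
have sizeE : size (mk_monic ('X^c : {poly K})) = c.+1.
  by rewrite mk_monic_trunc size_polyXn.
by rewrite -ltnS -sizeE; apply: size_mk_monic.
Qed.

Lemma coef_trunc p n : (n < c)%N -> (lift (trunc p))`_n = p`_n.
Proof.
move=> lt_nc; rewrite /= mk_monic_trunc.
rewrite {2}(Pdiv.RingMonic.rdivp_eq (monicXn K c) p) coefD coefMXn lt_nc.
by rewrite add0r.
Qed.

Lemma trunc_lift z : trunc (lift z) = z.
Proof.
by apply: val_inj; apply: in_qpoly_small; apply: size_mk_monic.
Qed.

Lemma trunc_eq0 p : (forall n, (n < c)%N -> p`_n = 0) -> trunc p = 0.
Proof.
move=> p0; apply: val_inj; apply/polyP => n; rewrite coef0.
have [lt_nc|le_cn] := ltnP n c; first by rewrite coef_trunc ?p0.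
by rewrite nth_default // (leq_trans (size_trunc _)).
Qed.

Lemma truncB p q : trunc (p - q) = trunc p - trunc q.
Proof. by rewrite in_qpolyD -scaleN1r in_qpolyZ scaleN1r. Qed.

Lemma coef_trunc_ord z : z != 0 ->
  [/\ (trunc_ord z < c)%N, (lift z)`_(trunc_ord z) != 0
    & forall m, (m < trunc_ord z)%N -> (lift z)`_m = 0].
Proof.
move=> z_neq0; have has_z : has (fun x : K => x != 0) (lift z).
  apply: contra_neqT z_neq0 => /hasPn all0; apply: val_inj; apply/polyP => n.
  rewrite coef0; have [lt_n|] := ltnP n (size (lift z)); last first.
    exact: nth_default.
  by apply/eqP; have := all0 _ (mem_nth 0 lt_n); rewrite negbK.
split; first by rewrite (leq_trans _ (size_trunc z)) -?has_find.
  exact: (nth_find 0 has_z).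
by move=> m /(before_find 0)/negbFE/eqP.
Qed.

Lemma trunc_ordE z n : (lift z)`_n != 0 ->
  (forall m, (m < n)%N -> (lift z)`_m = 0) -> z != 0 /\ trunc_ord z = n.
Proof.
move=> zn low; have z_neq0 : z != 0.
  by apply: contraNneq zn => ->; rewrite coef0.
split=> //; have [_ zord zlow] := coef_trunc_ord z_neq0.
case: (ltngtP (trunc_ord z) n) => // [/low z0|/zlow z0].
  by rewrite z0 eqxx in zord.
by rewrite z0 eqxx in zn.
Qed.

Section Subalgebras.
Variable A : set T.
Hypothesis subA : subalgebra A.

Lemma subalgebra1 : A 1.
Proof. by case: subA => /set_mem. Qed.

Lemma subalgebra_lin x y z : A y -> A z -> A (x *: y + z).
Proof.
case: subA => _ lin _ Ay Az; apply/set_mem; apply: lin; exact/mem_set.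
Qed.

Lemma subalgebraM y z : A y -> A z -> A (y * z).
Proof.
case: subA => _ _ mul Ay Az; apply/set_mem; apply: mul; exact/mem_set.
Qed.

Lemma subalgebra0 : A 0.
Proof.
by rewrite -(addNr 1) -scaleN1r; apply: subalgebra_lin; apply: subalgebra1.
Qed.

Lemma subalgebraZ x z : A z -> A (x *: z).
Proof.
by move=> Az; rewrite -[_ *: z]addr0; apply/subalgebra_lin/subalgebra0.
Qed.

Lemma subalgebraB y z : A y -> A z -> A (y - z).
Proof.
by move=> Ay Az; rewrite addrC -scaleN1r; apply: subalgebra_lin.
Qed.

Lemma subalgebraX z n : A z -> A (z ^+ n).
Proof.
move=> Az; elim: n => [|n IHn]; first exact: subalgebra1.
by rewrite exprS; apply: subalgebraM.
Qed.

Lemma generated_ring_min k (x : 'I_k -> T) :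
  (forall i, A (x i)) -> generated_ring x `<=` A.
Proof.
move=> Ax _ [P ->]; rewrite /mmap; elim/big_rec: _ => [|m z _ Az].
  exact: subalgebra0.
rewrite mulr_algl; apply: subalgebra_lin Az.
rewrite /mmap1; elim/big_rec: _ => [|i y _ Ay]; first exact: subalgebra1.
by apply: subalgebraM Ay; apply: subalgebraX.
Qed.

Lemma trunc_reduce_span (Gamma : set nat) (B : nat -> {poly K}) j p :
  (forall n, n \in Gamma -> A (trunc (B n))) ->
  A (trunc p - trunc (reduce Gamma B j p)).
Proof.
move=> AB; rewrite -truncB.
apply: (@reduce_span _ _ B (fun q => A (trunc q))) => [|x f g Af Ag|//].
  by rewrite rmorph0; apply: subalgebra0.
by rewrite in_qpolyD in_qpolyZ; apply: subalgebra_lin.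
Qed.

End Subalgebras.

Section GeneratedRing.
Variables (k : nat) (x : 'I_k -> {poly K}).
Local Notation gen := (generated_ring (fun i => trunc (x i))).

Lemma mmap_trunc (P : {mpoly K[k]}) :
  mmap (in_alg T) (fun i => trunc (x i)) P = trunc (mmap polyC x P).
Proof.
rewrite /mmap rmorph_sum; apply: eq_bigr => m _.
rewrite rmorphM /mmap1 rmorph_prod; congr (_ * _).
  by rewrite -alg_polyC -[RHS]/(trunc _) in_qpolyZ in_qpoly1.
by apply: eq_bigr => i _; rewrite rmorphXn.
Qed.

Lemma generated_ring_subalgebra : subalgebra gen.
Proof.
split=> [|b y z /set_mem[P ->] /set_mem[Q ->]|
         y z /set_mem[P ->] /set_mem[Q ->]]; apply/mem_set.
- by exists 1; rewrite rmorph1.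
- by exists (b *: P + Q); rewrite mmapD mmapZ mulr_algl.
- by exists (P * Q); rewrite rmorphM.
Qed.

Lemma generated_ring_monomial (m : 'X_{1..k}) :
  gen (trunc (\prod_i x i ^+ m i)).
Proof.
exists 'X_[m]; rewrite mmapX /mmap1 rmorph_prod.
by apply: eq_bigr => i _; rewrite rmorphXn.
Qed.

Lemma generated_ring_mem i : gen (trunc (x i)).
Proof. by exists 'X_i; rewrite mmapX mmap1U. Qed.

End GeneratedRing.

Section SemigroupAlgebra.
Variables (Gamma : set nat) (A : set T).
Hypothesis algA : algebras_of K Gamma c A.

(** A nonzero element would have a gap as its order. *)
Lemma algebra_gap_eq0 z : A z ->
  (forall n, (n < c)%N -> n \in Gamma -> (lift z)`_n = 0) -> z = 0.
Proof.
case: algA => _ GammaA Az z0; apply/eqP/negPn/negP => z_neq0.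
have [lt_c zord _] := coef_trunc_ord z_neq0; move/eqP: zord; apply.
by apply: z0 => //; apply/mem_set; rewrite -GammaA; left; exists z.
Qed.

Lemma algebra_leading n : n \in Gamma ->
  exists p, leading_at n p /\ A (trunc p).
Proof.
case: algA => subA GammaA; have [lt_nc|le_cn] := ltnP n c; last first.
  (* From c on, a power of t does, as it is 0 in the quotient. *)
  exists 'X^n; split; first exact: leading_atXn.
  rewrite trunc_eq0 => [|m lt_mc]; first exact: subalgebra0.
  by rewrite coefXn ltn_eqF // (leq_trans lt_mc).
move=> /set_mem; rewrite -{1}GammaA => -[[z Az [z_neq0 ord_z]]|]; last first.
  by rewrite /= leqNgt lt_nc.
have [_ zn low] := coef_trunc_ord z_neq0; rewrite ord_z in zn low.
exists (((lift z)`_n)^-1 *: lift z); split.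
  by split=> [|m lt_mn]; rewrite coefZ ?mulVf // (low m) // mulr0.
by rewrite in_qpolyZ trunc_lift; apply: subalgebraZ.
Qed.

End SemigroupAlgebra.

End TruncatedAlgebras.

(** * Series whose coefficients are polynomial functions *)

Section PolynomialFamilies.
Variables (K : fieldType) (I : finType).
Implicit Types f g : {ffun I -> K} -> {poly K}.

Definition polynomial_coefs f : Prop :=
  forall n, polynomial_fun (fun a => (f a)`_n).

Lemma polynomial_coefs_cst (p : {poly K}) : polynomial_coefs (fun=> p).
Proof. by move=> n; apply: polynomial_cst. Qed.

Lemma polynomial_coefsB f g : polynomial_coefs f -> polynomial_coefs g ->
  polynomial_coefs (fun a => f a - g a).
Proof.
move=> fP gP n; apply: (eq_polynomial (fun a => esym (coefB _ _ _))).
exact: polynomialB.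
Qed.

Lemma polynomial_coefsZ (h : {ffun I -> K} -> K) f :
  polynomial_fun h -> polynomial_coefs f ->
  polynomial_coefs (fun a => h a *: f a).
Proof.
move=> hP fP n; apply: (eq_polynomial (fun a => esym (coefZ _ _ _))).
exact: polynomialM.
Qed.

Lemma polynomial_coefsM f g : polynomial_coefs f -> polynomial_coefs g ->
  polynomial_coefs (fun a => f a * g a).
Proof.
move=> fP gP n; apply: (eq_polynomial (fun a => esym (coefM _ _ _))).
by apply: polynomial_sum => j; apply: polynomialM.
Qed.

Lemma polynomial_coefs_monomial k (x : 'I_k -> {ffun I -> K} -> {poly K})
    (m : 'X_{1..k}) : (forall i, polynomial_coefs (x i)) ->
  polynomial_coefs (fun a => \prod_i x i a ^+ m i).
Proof.
move=> xP; elim: (index_enum _) => [|i r IHr] n.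
  by apply: eq_polynomial (polynomial_coefs_cst 1 n) => a; rewrite big_nil.
have : polynomial_coefs (fun a => x i a ^+ m i * \prod_(j <- r) x j a ^+ m j).
  apply: polynomial_coefsM IHr; elim: (m i) => [|q IHq].
    exact: polynomial_coefs_cst.
  move=> s.
  apply: (eq_polynomial (fun a => congr1 (coefp s) (esym (exprS _ _)))).
  exact: polynomial_coefsM.
by move=> /(_ n); apply: eq_polynomial => a; rewrite big_cons.
Qed.

Lemma polynomial_coefs_reduce (Gamma : set nat)
    (B : nat -> {ffun I -> K} -> {poly K}) j f :
  (forall n, polynomial_coefs (B n)) -> polynomial_coefs f ->
  polynomial_coefs (fun a => reduce Gamma (B^~ a) j (f a)).
Proof.
move=> BP fP; elim: j => //= n IHn; rewrite /eliminate.
case: (n \in Gamma) => //.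
by apply: polynomial_coefsB => //; apply: polynomial_coefsZ.
Qed.

End PolynomialFamilies.

(** * Normal forms and the algebras they generate *)

Section NormalForms.
Variables (K : fieldType) (Gamma : set nat) (c k : nat) (v : 'I_k -> nat).
Local Notation coord := (gap_coord Gamma c v).
Implicit Types (p : coord) (a b : {ffun coord -> K}) (i : 'I_k) (m : 'X_{1..k}).

(** The lift of a normal form to polynomials, where a monomial of weighted
    degree at least c does not vanish but still has that order. *)
Definition nf_poly a i : {poly K} :=
  'X^(v i) + \sum_(p : coord | (val p).1 == i) a p *: 'X^((val p).2).

Lemma coord_intro i n : (n < c)%N -> n \notin Gamma -> (v i < n)%N ->
  exists p : coord, (val p).1 = i /\ (val p).2 = n :> nat.
Proof.
move=> lt_nc gap lt_vn.
pose isgap (q : 'I_k * 'I_c) := (val q.2 \notin Gamma) && (v q.1 < q.2)%N.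
have ok : isgap (i, Ordinal lt_nc) by rewrite /isgap gap.
by exists (exist isgap _ ok).
Qed.

Lemma nf_polyE a i n : (nf_poly a i)`_n = (n == v i)%:R +
  \sum_(p : coord | (val p).1 == i) a p * (n == (val p).2)%:R.
Proof.
rewrite coefD coefXn coef_sum; congr (_ + _); apply: eq_bigr => p _.
by rewrite coefZ coefXn.
Qed.

Lemma nf_poly_gap a (p : coord) : (nf_poly a (val p).1)`_((val p).2) = a p.
Proof.
have /andP[gap lt_vp] := valP p.
rewrite nf_polyE gtn_eqF // add0r (bigD1 p) //= eqxx mulr1.
rewrite big1 ?addr0 // => q /andP[/eqP q1 neq_qp].
case: eqP => [eq2|]; last by rewrite mulr0.
case/negP: neq_qp; apply/eqP/val_inj.
by rewrite [LHS]surjective_pairing [RHS]surjective_pairing q1 (ord_inj eq2).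
Qed.

Lemma nf_poly_nogap a i n : ~~ [&& (n < c)%N, n \notin Gamma & (v i < n)%N] ->
  (nf_poly a i)`_n = (n == v i)%:R.
Proof.
move=> nogap; rewrite nf_polyE big1 ?addr0 // => p /eqP p1.
case: eqP => [n_p|]; last by rewrite mulr0.
by case/negP: nogap; rewrite n_p ltn_ord -p1; apply: (valP p).
Qed.

Lemma nf_poly_leading a i : leading_at (v i) (nf_poly a i).
Proof.
split=> [|n lt_nv]; rewrite nf_poly_nogap ?ltnn ?andbF ?eqxx //.
  by rewrite ltn_eqF.
by rewrite [(v i < n)%N]ltnNge (ltnW lt_nv) !andbF.
Qed.

Lemma nf_poly_eq a b i n :
  (forall p : coord, (val p).1 = i -> (val p).2 = n :> nat -> a p = b p) ->
  (nf_poly a i)`_n = (nf_poly b i)`_n.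
Proof.
move=> ab; rewrite !nf_polyE; congr (_ + _); apply: eq_bigr => p /eqP p1.
by case: eqP => [n_p|]; rewrite ?mulr0 // ab.
Qed.

Lemma coord_lt p : (v (val p).1 < (val p).2)%N.
Proof. by have /andP[] := valP p. Qed.

(** With these weights, the coefficient of t^(n+w) in a monomial of weighted
    degree n is homogeneous of weight w in the coordinates. *)
Definition weight (p : coord) : nat := (val p).2 - v (val p).1.

Lemma weight_gt0 p : (0 < weight p)%N.
Proof. by rewrite subn_gt0 coord_lt. Qed.

Definition monomial a m : {poly K} := \prod_i nf_poly a i ^+ m i.

(** Linearization in weight w+1: when a and b agree in lower weights, the two
    values of a monomial first differ at relative order w+1, and there by the
    sum of the differences of the generators, counted with the exponents. *)
Lemma monomial_congr a b m w : (forall p, (weight p < w.+1)%N -> a p = b p) ->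
  congr_upto (wdeg v m) w.+1
    (\sum_i (m i)%:R *
       ((nf_poly a i)`_(v i + w.+1) - (nf_poly b i)`_(v i + w.+1)))
    (monomial a m) (monomial b m).
Proof.
move=> ab; apply: congr_prod => i; apply: congr_intro.
  exact: nf_poly_leading.
move=> n lt_n; apply: nf_poly_eq => p p1 p2; apply: ab.
have /andP[_ lt_vp] := valP p.
by rewrite /weight p1 p2 -ltnS; lia.
Qed.

Lemma monomial_leading a m : leading_at (wdeg v m) (monomial a m).
Proof. by apply: congr_leading (@monomial_congr a a m 0 _). Qed.

Lemma polynomial_coefs_nf i : polynomial_coefs (nf_poly ^~ i).
Proof.
move=> n; apply: (eq_polynomial (fun a => esym (nf_polyE a i n))).
apply: polynomialD; first exact: polynomial_cst.
by apply: polynomial_sum => p; apply: polynomialM;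
  [apply: polynomial_coord | apply: polynomial_cst].
Qed.

Lemma polynomial_coefs_nf_monomial m : polynomial_coefs (monomial ^~ m).
Proof.
by apply: polynomial_coefs_monomial => i; apply: polynomial_coefs_nf.
Qed.

Hypothesis c_gt0 : (0 < c)%N.
Hypothesis Gamma_span : Gamma = semigroup_span v [set: 'I_k]%SET.

Lemma wdeg_in m : wdeg v m \in Gamma.
Proof.
apply/mem_set; rewrite Gamma_span; exists m.
by apply: eq_bigl => i; rewrite inE.
Qed.

Lemma exists_monomial : exists mon : nat -> 'X_{1..k},
  forall n, n \in Gamma -> wdeg v (mon n) = n.
Proof.
suff /choice[mon monE] :
    forall n, exists m : 'X_{1..k}, n \in Gamma -> wdeg v m = n by exists mon.
move=> n; have [/set_mem|] := boolP (n \in Gamma); last by exists 0%MM.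
rewrite Gamma_span => -[e ->]; exists [multinom e i | i < k] => _.
by apply: eq_big => [i|i _]; rewrite ?inE ?mnmE.
Qed.

Lemma generator_in i : v i \in Gamma.
Proof.
have := wdeg_in U_(i); rewrite /wdeg (bigD1 i) //= mnm1E eqxx mul1n.
by rewrite big1 ?addn0 // => j /negbTE; rewrite mnm1E eq_sym => ->.
Qed.

(** The two i-th normal forms lie in the same algebra, and their leading terms
    cancel: the difference only has coefficients at gaps. *)
Lemma normal_form_inj :
  set_inj (variety_of K Gamma c v) (fun a => generated_ring (normal_form a)).
Proof.
move=> a b /set_mem Va _ gen_ab; apply/ffunP => p.
have diff0 : in_qpoly 'X^c (nf_poly a (val p).1 - nf_poly b (val p).1) = 0.
  apply: (algebra_gap_eq0 c_gt0 Va); last first.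
    move=> n lt_nc Gn; rewrite coef_trunc // coefB !nf_poly_nogap ?subrr //;
    by rewrite Gn andbF.
  rewrite truncB; apply: (subalgebraB Va.1).
    exact: (generated_ring_mem c (nf_poly a)).
  by rewrite gen_ab; apply: (generated_ring_mem c (nf_poly b)).
have := congr1 (fun z : truncated K c => (z : {poly K})`_((val p).2)) diff0.
rewrite coef_trunc ?ltn_ord // coefB !nf_poly_gap coef0.
by move/eqP; rewrite subr_eq0 => /eqP.
Qed.

(** Reducing t^(v_i) with elements of A of all orders in Gamma subtracts an
    element of A and leaves coefficients at gaps above v_i only: so
    t^(v_i) minus the remainder is an element of A in normal form.  The
    monomials in these elements have all orders in Gamma, and elimination with
    them shows that they span A. *)
Lemma normal_form_surj :
  set_surj (variety_of K Gamma c v) (algebras_of K Gamma c)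
    (fun a => generated_ring (normal_form a)).
Proof.
move=> A algA; have [subA GammaA] := algA.
have leadA n : exists f : {poly K}, n \in Gamma ->
    leading_at n f /\ A (in_qpoly 'X^c f).
  have [/(algebra_leading c_gt0 algA)[f Af]|] := boolP (n \in Gamma).
    by exists f.
  by exists 0.
have /choice[B BE] := leadA.
have leadB n : n \in Gamma -> leading_at n (B n) by move=> /BE[].
pose a : {ffun coord -> K} :=
  [ffun p : coord => - (reduce Gamma B c 'X^(v (val p).1))`_((val p).2)].
have nfE i : normal_form a i =
    in_qpoly 'X^c ('X^(v i)) - in_qpoly 'X^c (reduce Gamma B c 'X^(v i)).
  rewrite -[normal_form a i]/(in_qpoly 'X^c (nf_poly a i)) -truncB.
  apply/eqP; rewrite -subr_eq0 -truncB; apply/eqP.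
  apply: trunc_eq0 => // n lt_nc; rewrite 2!coefB coefXn.
  have [/and3P[_ gap lt_vn]|nogap] :=
      boolP [&& (n < c)%N, n \notin Gamma & (v i < n)%N].
    have [p [p1 p2]] := coord_intro lt_nc gap lt_vn.
    rewrite -p2 -p1 nf_poly_gap ffunE p1 p2 gtn_eqF //.
    by rewrite add0r subrr.
  rewrite nf_poly_nogap //.
  suff -> : (reduce Gamma B c 'X^(v i))`_n = 0 by rewrite subr0 subrr.
  have [Gn|gap] := boolP (n \in Gamma); first exact: reduce_Gamma.
  apply: (reduce_low leadB c (N := v i)) => [m lt_mv|].
    by rewrite coefXn ltn_eqF.
  move: nogap; rewrite lt_nc gap /= -leqNgt leq_eqVlt => /predU1P[n_v|//].
  by move: gap; rewrite n_v generator_in.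
have nfA i : A (normal_form a i).
  by rewrite nfE; apply: (trunc_reduce_span subA) => // n /BE[].
have genA : generated_ring (normal_form a) `<=` A by apply: generated_ring_min.
have genE : generated_ring (normal_form a) = A.
  apply/seteqP; split=> // z Az.
  have sub_gen : subalgebra (generated_ring (normal_form a)).
    exact: (generated_ring_subalgebra c (nf_poly a)).
  have [mon monE] := exists_monomial.
  have leadM n : n \in Gamma -> leading_at n (monomial a (mon n)).
    by move=> Gn; rewrite -{1}(monE n Gn); apply: monomial_leading.
  set M := fun n => monomial a (mon n) in leadM.
  have span : generated_ring (normal_form a)
      (in_qpoly 'X^c z - in_qpoly 'X^c (reduce Gamma M c z)).
    apply: (trunc_reduce_span sub_gen) => n _.
    exact: (generated_ring_monomial c (nf_poly a)).
  rewrite trunc_lift in span.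
  suff red0 : in_qpoly 'X^c (reduce Gamma M c z) = 0.
    by rewrite red0 subr0 in span.
  apply: (algebra_gap_eq0 c_gt0 algA) => [|n lt_nc Gn].
    have := subalgebraB subA Az (genA _ span).
    by rewrite opprB addrC subrK.
  by rewrite coef_trunc // reduce_Gamma.
by exists a => //; rewrite /variety_of /= genE.
Qed.

End NormalForms.

(** * The colliding pair of monomials *)

Section SingleBinomial.
Variables (K : fieldType) (c k : nat) (v : 'I_k -> nat).
Hypothesis charK0 : [pchar K] =i pred0.
Implicit Types m : 'X_{1..k}.

Lemma worder_binomial e e' : e <> e' -> wdeg v e = wdeg v e' ->
  worder v ('X_[e] - 'X_[e'] : {mpoly K[k]}) = wdeg v e.
Proof.
move=> /eqP neq_e eq_deg; set P := _ - _.
have deg_supp m : m \in msupp P -> wdeg v m = wdeg v e.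
  rewrite mcoeff_msupp mcoeffB !mcoeffX.
  case: (e =P m) => [->//|_]; case: (e' =P m) => [<-//|_].
  by rewrite subrr eqxx.
have P_neq0 : P != 0.
  apply: contraTneq isT => P0; have /eqP := mcoeff0 K e.
  rewrite -P0 mcoeffB !mcoeffX eqxx [e' == e]eq_sym (negbTE neq_e) subr0.
  by rewrite oner_eq0.
rewrite /worder deg_supp ?mlead_supp // big_seq.
by elim/big_rec: _ => // m x /deg_supp -> ->; rewrite minnn.
Qed.

(** The sign convention in [S_dec] merely orders the two monomials: the first
    index at which they differ decides. *)
Lemma S_dec_total m m' : m <> m' -> wdeg v m = wdeg v m' ->
  S_dec K v ('X_[m] - 'X_[m']) \/ S_dec K v ('X_[m'] - 'X_[m]).
Proof.
move=> neq_m eq_deg; have [i0 neq_i0] : exists i, m i != m' i.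
  apply/existsP; rewrite -negb_forall; apply/forallP => eq_m.
  by apply: neq_m; apply/mnmP => i; apply/eqP.
case: (@arg_minnP _ i0 (fun i => m i != m' i) val neq_i0) => i neq_i min_i.
have eq_lt (j : 'I_k) : (j < i)%N -> m j = m' j.
  move=> lt_ji; apply/eqP; apply: contraTT lt_ji => /min_i.
  by rewrite -leqNgt.
have [lt_i|lt_i|eq_i] := ltngtP (m i) (m' i).
- by left; exists m, m'; split=> //; exists i.
- right; exists m', m; split=> //; first by move/esym.
  by exists i; split=> // j /eq_lt.
- by rewrite eq_i eqxx in neq_i.
Qed.

Lemma binomial_inj m m' (e e' : 'X_{1..k}) : m <> m' ->
  'X_[m] - 'X_[m'] = 'X_[e] - 'X_[e'] :> {mpoly K[k]} -> m = e /\ m' = e'.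
Proof.
move=> /eqP/negbTE neq_m eq_mm.
have N1_neq1 : (-1 == 1 :> K) = false.
  by rewrite eq_sym -subr_eq0 opprK; apply: (iffLR (pcharf0P K) charK0 2).
have em : e = m.
  apply/eqP/negPn/negP => /negbTE neq_em; have /eqP := congr1 (mcoeff m) eq_mm.
  rewrite !mcoeffB !mcoeffX eqxx [m' == m]eq_sym neq_m neq_em subr0 sub0r.
  by case: (e' == m); rewrite ?oppr0 ?oner_eq0 // eq_sym N1_neq1.
split=> //; apply/esym/eqP/negPn/negP => /negbTE neq_em'.
have /eqP := congr1 (mcoeff m') eq_mm.
rewrite !mcoeffB !mcoeffX eqxx em neq_m neq_em' subr0 sub0r.
by rewrite oppr_eq0 oner_eq0.
Qed.

(** [S_dec] contains all homogeneous binomials, reducible ones included, so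
    two monomials of equal degree below c are always the two terms of P. *)
Lemma collision_unique (P : {mpoly K[k]}) :
  S_dec K v `&` [set Q | (worder v Q < c)%N] = [set P] ->
  exists e e' : 'X_{1..k},
    [/\ exists i, (e i < e' i)%N, wdeg v e = wdeg v e',
        worder v P = wdeg v e, (wdeg v e < c)%N
      & forall m m', m <> m' -> wdeg v m = wdeg v m' -> (wdeg v m < c)%N ->
          (m = e /\ m' = e') \/ (m = e' /\ m' = e)].
Proof.
move=> SP.
have [] : (S_dec K v `&` [set Q | (worder v Q < c)%N]) P by rewrite SP.
case=> e [e' [neq_e [i [_ lt_i]] eq_deg PE]] /=.
rewrite {1}PE worder_binomial // => lt_c; exists e, e'.
split=> //; first by exists i.
  by rewrite PE worder_binomial.
move=> m m' neq_m eq_m lt_m.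
have uniq Q : S_dec K v Q -> worder v Q = wdeg v m -> Q = P.
  by move=> SQ ordQ; have : [set P] Q by rewrite -SP; split=> //=; rewrite ordQ.
have [Sm|Sm] := S_dec_total neq_m eq_m; have := uniq _ Sm.
  rewrite worder_binomial // => /(_ erefl); rewrite PE.
  by move=> /binomial_inj; left; auto.
rewrite worder_binomial //; last exact/nesym.
rewrite eq_m => /(_ erefl); rewrite PE => /(binomial_inj (nesym neq_m))[-> ->].
by right.
Qed.

End SingleBinomial.

(** * The obstructions to having the prescribed semigroup *)

Section SingleRelation.
Variables (K : fieldType) (Gamma : set nat) (c k : nat) (v : 'I_k -> nat).
Variables (e e' : 'X_{1..k}) (i0 : 'I_k).
Local Notation coord := (gap_coord Gamma c v).
Local Notation trunc := (in_qpoly ('X^c : {poly K})).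
Local Notation d := (wdeg v e).
Hypothesis charK0 : [pchar K] =i pred0.
Hypothesis GammaD :
  forall m n, m \in Gamma -> n \in Gamma -> (m + n)%N \in Gamma.
Hypothesis Gamma_ge_c : forall n, (c <= n)%N -> n \in Gamma.
Hypothesis Gamma_span : Gamma = semigroup_span v [set: 'I_k]%SET.
Hypothesis lt_dc : (d < c)%N.
Hypothesis eq_deg : d = wdeg v e'.
Hypothesis lt_e_i0 : (e i0 < e' i0)%N.
Hypothesis collision : forall m m' : 'X_{1..k}, m <> m' ->
  wdeg v m = wdeg v m' -> (wdeg v m < c)%N ->
  (m = e /\ m' = e') \/ (m = e' /\ m' = e).
Implicit Types (a b : {ffun coord -> K}) (p : coord).

Let c_gt0 : (0 < c)%N. Proof. exact: leq_ltn_trans lt_dc. Qed.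

Let gap_lt_c n : n \notin Gamma -> (n < c)%N.
Proof. by apply: contraR; rewrite -leqNgt => /Gamma_ge_c. Qed.

Variable mon : nat -> 'X_{1..k}.
Hypothesis monE : forall n, n \in Gamma -> wdeg v (mon n) = n.

Let B a n := monomial a (mon n).

Let leadB a n : n \in Gamma -> leading_at n (B a n).
Proof. by move=> Gn; rewrite -{1}(monE Gn); apply: monomial_leading. Qed.

Let relation a : {poly K} := monomial a e - monomial a e'.

(** For n a gap above d, the coefficient at n of what elimination leaves of the
    relation between the two monomials of degree d. *)
Definition obstruction n a := (reduce Gamma (B a) c (relation a))`_n.

Let polynomial_obstruction n : polynomial_fun (obstruction n).
Proof.
apply: (@polynomial_coefs_reduce _ _ Gamma (fun n a => B a n)) => [m|].
  exact: polynomial_coefs_nf_monomial.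
by apply: polynomial_coefsB; apply: polynomial_coefs_nf_monomial.
Qed.

Let relation_low a n : (n <= d)%N -> (relation a)`_n = 0.
Proof.
have [lead1 low] := monomial_leading a e.
have := monomial_leading a e'; rewrite -eq_deg => -[lead1' low'].
rewrite leq_eqVlt => /predU1P[->|lt_nd]; rewrite coefB.
  by rewrite lead1 lead1' subrr.
by rewrite low // low' // subrr.
Qed.

Let obstruction_low a n : (n <= d)%N -> obstruction n a = 0.
Proof.
move=> le_nd; apply: (reduce_low (@leadB a) c (N := d.+1)) => // m.
exact: relation_low.
Qed.

Lemma obstruction_variation a b w : (d + w.+1)%N \notin Gamma ->
  (forall p, (weight p < w.+1)%N -> a p = b p) ->
  obstruction (d + w.+1) a - obstruction (d + w.+1) b =
  \sum_i ((e i)%:R - (e' i)%:R) *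
     ((nf_poly a i)`_(v i + w.+1) - (nf_poly b i)`_(v i + w.+1)).
Proof.
move=> gap ab; have congE := @monomial_congr _ _ _ _ _ a b _ w ab.
rewrite (reduce_congr c (@leadB a) (@leadB b)) //; first last.
- move=> n lt_nw; rewrite !coefB.
  rewrite (congr_low (congE e)) ?ltn_add2l //.
  by rewrite (congr_low (congE e')) // -eq_deg ltn_add2l.
- exact: relation_low.
- exact: relation_low.
- move=> n m Gn lt_mw; apply: (congr_low (congE (mon n))).
  by rewrite monE ?ltn_add2l.
rewrite !coefB; have := congr_diff (congE e').
rewrite -eq_deg => diff'; have diff := congr_diff (congE e).
under eq_bigr do rewrite mulrBl.
by rewrite sumrB -diff -diff'; ring.
Qed.

(** The coordinates of x_i0 that the obstructions determine: the one of weight w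
    is tied to the obstruction at d + w. *)
Definition pivot p : bool :=
  ((val p).1 == i0) && (((val p).2 + (d - v i0))%N \notin Gamma).

Let v_i0_le_d : (v i0 <= d)%N.
Proof.
rewrite eq_deg /wdeg (bigD1 i0) //=; case: (e' i0) lt_e_i0 => // n _.
by rewrite mulSn -addnA leq_addr.
Qed.

Let d_sub_in : (d - v i0)%N \in Gamma.
Proof.
have -> : (d - v i0)%N = wdeg v (e' - U_(i0))%MM.
  rewrite eq_deg /wdeg (bigD1 i0) //= [RHS](bigD1 i0) //= mnmBE mnm1E eqxx.
  have -> : (e' i0 * v i0 = (e' i0 - 1) * v i0 + v i0)%N.
    by rewrite -mulSnr subn1 prednK // (leq_ltn_trans _ lt_e_i0).
  rewrite addnAC addnK; congr (_ + _)%N; apply: eq_bigr => i /negbTE neq_i.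
  by rewrite mnmBE mnm1E eq_sym neq_i subn0.
exact: wdeg_in.
Qed.

Let pivot_degree p : pivot p -> ((val p).2 + (d - v i0) = d + weight p)%N.
Proof.
move=> /andP[/eqP p1 _]; have := coord_lt p; rewrite /weight p1 => lt_v.
by rewrite !addnBA ?(ltnW lt_v) // addnC.
Qed.

(** If n - (d - v i0) were in Gamma, adding d - v i0 would put n there. *)
Let coord_of_gap n : (d < n)%N -> n \notin Gamma ->
  exists p, pivot p /\ n = (d + weight p)%N.
Proof.
move=> lt_dn gap.
have shift : (n - (d - v i0) + (d - v i0) = n)%N by have := v_i0_le_d; lia.
have gap' : (n - (d - v i0))%N \notin Gamma.
  by apply: contra gap => Gn; rewrite -shift; apply: GammaD.
have lt_v : (v i0 < n - (d - v i0))%N by have := v_i0_le_d; lia.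
have [p [p1 p2]] := coord_intro (gap_lt_c gap') gap' lt_v.
have pivot_p : pivot p by rewrite /pivot p1 eqxx p2 shift.
by exists p; rewrite -pivot_degree // p2 shift.
Qed.

(** In the linear term of [obstruction_variation] only the summand i0 can be
    nonzero, as the coordinates of the other generators are not pivots. *)
Lemma pivot_triangular p a b : pivot p ->
  (forall q, ~~ pivot q \/ (weight q < weight p)%N -> a q = b q) ->
  obstruction (d + weight p) a - obstruction (d + weight p) b =
  ((e i0)%:R - (e' i0)%:R) * (a p - b p).
Proof.
move=> pivot_p ab; have /andP[/eqP p1 gap] := pivot_p.
rewrite pivot_degree // in gap.
have wE : weight p = (weight p).-1.+1 by rewrite prednK ?weight_gt0.
have vw : (v i0 + weight p = (val p).2)%N.
  by have := coord_lt p; rewrite /weight p1 => lt_v; rewrite subnKC // ltnW.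
rewrite wE obstruction_variation -?wE //; last first.
  by move=> q lt_q; apply: ab; right.
rewrite (bigD1 i0) //= vw -p1 !nf_poly_gap p1 big1 ?addr0 // => i neq_i.
rewrite (@nf_poly_eq _ _ _ _ _ a b) ?subrr ?mulr0 // => q q1 _.
by apply: ab; left; rewrite /pivot q1 (negbTE neq_i).
Qed.

Let null a (f : {poly K}) : Prop :=
  forall n, (n < c)%N -> (reduce Gamma (B a) c f)`_n = 0.

Let nullD a f g : null a f -> null a g -> null a (f + g).
Proof. by move=> f0 g0 n lt_n; rewrite reduceD coefD f0 ?g0 ?addr0. Qed.

Let nullZ a x f : null a f -> null a (x *: f).
Proof. by move=> f0 n lt_n; rewrite reduceZ coefZ f0 ?mulr0. Qed.

(** Below c each monomial is the chosen one of its degree, or differs from it by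
    the relation, so it reduces to 0 as soon as the relation does. *)
Lemma obstruction_null a : (forall n, (n < c)%N -> obstruction n a = 0) ->
  forall P : {mpoly K[k]}, null a (mmap polyC (nf_poly a) P).
Proof.
move=> /= obs0 P; have relation0 : null a (relation a) by [].
have mon0 n : n \in Gamma -> (n < c)%N -> null a (B a n).
  by move=> Gn lt_n m lt_m; rewrite reduce_basis ?coef0 // => ?; apply: leadB.
have e_e'0 : null a (monomial a e) /\ null a (monomial a e').
  have e0 : null a (monomial a e) -> null a (monomial a e').
    move=> e0; rewrite -[monomial a e'](subKr (monomial a e)).
    by apply: nullD => //; rewrite -scaleN1r; apply: nullZ.
  have e'0 : null a (monomial a e') -> null a (monomial a e).
    by move=> e'0; rewrite -[monomial a e](subrK (monomial a e')); apply: nullD.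
  have Gd : d \in Gamma by apply: wdeg_in.
  have := mon0 d Gd lt_dc; rewrite /B; have [->|/eqP neq_e] := eqVneq (mon d) e.
    by move=> m0; split; auto.
  have [||[-> _]|[-> _]] := collision neq_e; rewrite ?monE //.
    by move=> m0; split; auto.
  by move=> m0; split; auto.
have monomial0 m : null a (monomial a m).
  have [lt_m|le_c] := ltnP (wdeg v m) c; last first.
    move=> n lt_n; apply: (reduce_low (@leadB a) c (N := c)) => // j lt_j.
    by case: (monomial_leading a m) => _ low; apply/low/(leq_trans lt_j).
  have Gm : wdeg v m \in Gamma by apply: wdeg_in.
  have [->|/eqP neq_m] := eqVneq m (mon (wdeg v m)); first exact: mon0.
  by have [||[-> _]|[-> _]] := collision neq_m; rewrite ?monE //; apply e_e'0.
rewrite /mmap; elim/big_ind: _ => [|f g f0 g0|m _].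
- by move=> n _; rewrite reduce0 coef0.
- exact: nullD.
- by rewrite mul_polyC; apply/nullZ/monomial0.
Qed.

(** If the algebra has semigroup Gamma, the reduced relation is an element of it
    without coefficients at orders in Gamma, hence 0.  Conversely, if all
    elements reduce to 0, none has a gap as its order, since reduction would
    preserve the leading coefficient. *)
Lemma variety_pivots :
  variety_of K Gamma c v =
  [set a | forall p, pivot p -> obstruction (d + weight p) a = 0].
Proof.
have subA a : subalgebra (generated_ring (normal_form a)).
  exact: (generated_ring_subalgebra c (nf_poly a)).
have memA a m : generated_ring (normal_form a) (trunc (monomial a m)).
  exact: (generated_ring_monomial c (nf_poly a)).
apply/seteqP; split=> a.
  move=> Va p /= pivot_p.
  have red0 : trunc (reduce Gamma (B a) c (relation a)) = 0.
    apply: (algebra_gap_eq0 c_gt0 Va) => [|n lt_n Gn]; last first.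
      by rewrite coef_trunc // reduce_Gamma // => ?; apply: leadB.
    have Arel : generated_ring (normal_form a) (trunc (relation a)).
      by rewrite truncB; apply: subalgebraB.
    have span : generated_ring (normal_form a)
        (trunc (relation a) - trunc (reduce Gamma (B a) c (relation a))).
      by apply: trunc_reduce_span => // n _; apply: memA.
    by have := subalgebraB (subA a) Arel span; rewrite opprB addrC subrK.
  have /andP[_] := pivot_p; rewrite pivot_degree // => /gap_lt_c lt_c.
  have := congr1 (fun z : truncated K c => (z : {poly K})`_(d + weight p)) red0.
  by rewrite coef_trunc // coef0.
move=> pivot0; have obs0 n : (n < c)%N -> obstruction n a = 0.
  move=> lt_n; have [/obstruction_low -> //|lt_dn] := leqP n d.
  have [Gn|gap] := boolP (n \in Gamma).
    by apply: reduce_Gamma => // ?; apply: leadB.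
  by have [p [pivot_p ->]] := coord_of_gap lt_dn gap; apply: pivot0.
split=> //; apply/seteqP; split=> [n|n Gn].
  case=> [[z [P ->]] [z_neq0 <-]|/= /Gamma_ge_c/set_mem //].
  have [lt_c zord low] := coef_trunc_ord c_gt0 z_neq0.
  set n0 := trunc_ord _ in lt_c zord low *.
  apply/set_mem/negPn/negP => gap; case/negP: zord.
  have zE : mmap (in_alg (truncated K c)) (normal_form a) P = _ :=
    mmap_trunc c (nf_poly a) P.
  rewrite zE in low *.
  rewrite coef_trunc //; set Q := mmap _ _ _ in low *.
  rewrite -(reduce_gap_lead (@leadB a) c gap) => [|m lt_m].
    by apply/eqP; apply: obstruction_null.
  by rewrite -(coef_trunc c_gt0 Q (ltn_trans lt_m lt_c)) low.
have [lt_nc|le_cn] := ltnP n c; last by right.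
left; exists (trunc (monomial a (mon n))) => //.
have [lead1 low] := leadB a (mem_set Gn).
apply: trunc_ordE => // [|m lt_m].
  by rewrite coef_trunc ?lead1 ?oner_eq0.
by rewrite coef_trunc ?low // (ltn_trans lt_m).
Qed.

Lemma card_pivot : #|pivot| = gaps_gt Gamma c d.
Proof.
pose shift p : 'I_c := insubd (val p).2 ((val p).2 + (d - v i0))%N.
have shiftE p : pivot p -> shift p = (d + weight p)%N :> nat.
  move=> pivot_p; rewrite /shift val_insubd pivot_degree //.
  by have /andP[_] := pivot_p; rewrite pivot_degree // => /gap_lt_c ->.
rewrite -(@card_in_image _ _ shift) => [|p q pivot_p pivot_q eq_pq].
  apply: eq_card => n; rewrite [RHS]inE; apply/fintype.imageP/andP.
    case=> p pivot_p ->; rewrite /= shiftE // -{1}pivot_degree //.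
    by have /andP[_ ->] := pivot_p; rewrite -{1}(addn0 d) ltn_add2l weight_gt0.
  move=> [gap lt_dn]; have [p [pivot_p n_p]] := coord_of_gap lt_dn gap.
  by exists p => //; apply: val_inj; rewrite /= shiftE.
have /andP[/eqP p1 _] := pivot_p; have /andP[/eqP q1 _] := pivot_q.
have : (d + weight p = d + weight q)%N by rewrite -!shiftE // eq_pq.
rewrite -!pivot_degree // => /addIn eq2; apply: val_inj.
by rewrite [LHS]surjective_pairing [RHS]surjective_pairing p1 q1 (ord_inj eq2).
Qed.

Lemma single_relation_variety :
  zariski_closed (variety_of K Gamma c v) /\
  affine_isomorphic (variety_of K Gamma c v)
    [set: {ffun 'I_(N_of Gamma c v d) -> K}].
Proof.
have slope_neq0 : (e i0)%:R - (e' i0)%:R != 0 :> K.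
  rewrite -oppr_eq0 opprB -natrB ?(ltnW lt_e_i0) //.
  by rewrite (iffLR (pcharf0P K) charK0) subn_eq0 -ltnNge.
rewrite variety_pivots; split.
  by apply: triangular_zariski_closed => p _; apply: polynomial_obstruction.
apply: (triangular_affine_isomorphic slope_neq0) => [p _|p a b|].
- exact: polynomial_obstruction.
- exact: pivot_triangular.
by rewrite /N_of -card_gap_coord -card_pivot -(cardC pivot) addKn.
Qed.

End SingleRelation.

Theorem proposition4p1 (R : realType) (Gamma : set nat) (c g : nat)
    (v : 'I_g.+1 -> nat) (P : {mpoly R[i][g.+1]}) :
  numerical_semigroup Gamma ->
  is_conductor Gamma c ->
  minimal_generators Gamma v ->
  (forall i j : 'I_g.+1, (i < j)%N -> (v i < v j)%N) ->
  S_dec R[i] v `&` [set Q | (worder v Q < c)%N] = [set P] ->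
  let d := worder v P in
  let V : set {ffun gap_coord Gamma c v -> R[i]} :=
    variety_of R[i] Gamma c v in
  let affine_space : set {ffun 'I_(N_of Gamma c v d) -> R[i]} := [set: _] in
  [/\ set_bij V (algebras_of R[i] Gamma c)
        (fun a => generated_ring (normal_form a)),
      zariski_closed V
    & affine_isomorphic V affine_space].
Proof.
move=> [_ GammaD _] [Gamma_ge_c _] [Gamma_span _] _ singleP.
have charC0 : [pchar R[i]] =i pred0 by apply: Num.Theory.pchar_num.
have [e [e' [[i0 lt_i0] eq_deg -> lt_c collision]]] :=
  collision_unique charC0 singleP.
have [mon monE] := exists_monomial Gamma_span.
have c_gt0 : (0 < c)%N by apply: leq_ltn_trans lt_c.
have [| |closedV isoV] := single_relation_variety charC0 _ _ Gamma_span
  lt_c eq_deg lt_i0 collision monE.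
- by move=> m n /set_mem Gm /set_mem Gn; apply/mem_set/GammaD.
- by move=> n /Gamma_ge_c/mem_set.
split=> //; split.
- by [].
- exact: normal_form_inj.
- exact: normal_form_surj.
Qed.
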